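(* Let $G$ be a connected amply regular graph (simple, locally finite) with parameters $(d,\alpha,\beta)$ with $\beta>1$. If $G$ has an even or infinite number of vertices, then $G$ has a perfect matching.
   Context: All graphs are simple and locally finite (every vertex has finite degree), possibly infinite. A $d$-regular graph $G$ which is neither complete nor empty (i.e. not edgeless) is called amply regular with parameters $(d,\alpha,\beta)$ if any two adjacent vertices have exactly $\alpha$ common neighbors, and any two vertices at distance two have exactly $\beta$ common neighbors. A matching of $G$ is a set of mutually disjoint edges; it is perfect if every vertex of $G$ is incident with an edge of the matching. *)

(* Defs.v *)
From mathcomp Require Import all_boot.
From mathcomp Require Import boolp classical_sets functions cardinality.

Set Implicit Arguments.
Unset Strict Implicit.
Unset Printing Implicit Defensive.

Local Open Scope classical_set_scope.
Local Open Scope card_scope.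

(* Simple graphs on an arbitrary, possibly infinite, type of vertices. *)
Record sgraph := SGraph {
  vertex :> Type;
  adj : vertex -> vertex -> Prop;
  adj_sym : forall x y, adj x y -> adj y x;
  adj_irrefl : forall x, ~ adj x x
}.

Definition neighbors (G : sgraph) (x : G) : set G := [set y | adj x y].

Definition common_neighbors (G : sgraph) (x y : G) : set G :=
  neighbors x `&` neighbors y.

Definition locally_finite (G : sgraph) : Prop :=
  forall x : G, finite_set (neighbors x).

Definition regular (G : sgraph) (d : nat) : Prop :=
  forall x : G, neighbors x #= `I_d.

Definition complete (G : sgraph) : Prop :=
  forall x y : G, x <> y -> adj x y.

Definition edgeless (G : sgraph) : Prop :=
  forall x y : G, ~ adj x y.

Fixpoint walk (G : sgraph) (n : nat) (x y : G) : Prop :=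
  if n is m.+1 then exists2 z, adj x z & walk m z y else x = y.

Definition connected_graph (G : sgraph) : Prop :=
  forall x y : G, exists n, walk n x y.

Definition at_distance (G : sgraph) (n : nat) (x y : G) : Prop :=
  walk n x y /\ forall m, m < n -> ~ walk m x y.

Definition amply_regular (G : sgraph) (d alpha beta : nat) : Prop :=
  [/\ regular G d,
      ~ complete G,
      ~ edgeless G,
      forall x y : G, adj x y -> common_neighbors x y #= `I_alpha &
      forall x y : G, at_distance 2 x y -> common_neighbors x y #= `I_beta].

Definition edges (G : sgraph) : set (set G) :=
  [set e | exists x y : G, adj x y /\ e = [set x; y]].

Definition matching (G : sgraph) (M : set (set G)) : Prop :=
  M `<=` @edges G /\ trivIset M id.

Definition perfect_matching (G : sgraph) (M : set (set G)) : Prop :=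
  matching M /\ forall x : G, exists2 e, M e & e x.

(* Main.v *)
Require Import Defs.
From mathcomp Require Import all_boot zify.

(** The argument has three parts.

    Edge cuts.  Every set of vertices that contains an end x but not the other
    end y of an edge has at least d edges leaving it.  Indeed there is a flow
    of value d from x to y whose load on each edge is at most 1, supported near
    the edge xy: one unit on the edge itself, one unit out of x towards each
    other neighbour and one unit into y from each other neighbour, and, with
    b = beta - 1 > 0, a load of 1/b on every edge that leads from N(x) minus y
    to N(y) minus x and does not lie inside the intersection of N(x) and N(y).  A vertex of N(x) that is
    neither y nor adjacent to y is at distance two from y, so it has exactly
    b neighbours in N(y) besides x and passes on its unit; symmetrically at y.
    A common neighbour u of x and y has alpha common neighbours with x and
    alpha with y, hence as many neighbours in N(x) outside N(y) as in N(y)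
    outside N(x), so the flow is conserved there as well
    ([local_cut_bound], where all loads are multiplied by b).

    Finite matchings.  The Tutte-Berge theorem ([berge]) is proved by deleting
    a vertex covered by all maximum matchings or, if there is none, by Gallai's
    lemma ([gallai_lemma]).  It is applied to a finite set W of vertices of
    even size, in which the vertices outside a set F of inner vertices are
    made pairwise adjacent.  If there were no perfect matching, some S would
    leave at least |S| + 2 odd parts without edges between them; at most one of
    them leaves F, and each of the others sends at least d edges to S, which
    can only receive d |S|.  So some matching covers F ([even_cut_cover],
    [interior_matching]).  When the graph is infinite, W can be enlarged to have
    even size.

    Compactness.  A limit along an ultrafilter on the finite sets of vertices
    turns the matchings covering these finite sets into a perfect matching
    ([matching_compactness]). *)

Set Implicit Arguments.
Unset Strict Implicit.
Unset Printing Implicit Defensive.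

(** * Flows and edge cuts *)

(** Number of common neighbours of [x] and [y]. *)
Definition codeg (T : finType) (e : rel T) (x y : T) : nat :=
  \sum_u (e x u && e y u : nat).

(** Number of edges with exactly one end in [A]. *)
Definition cut_size (T : finType) (e : rel T) (A : {set T}) : nat :=
  \sum_(u in A) \sum_(v | v \notin A) (e u v : nat).

(** A flow [F] of value [k] from [x] to [y], with capacity [b] on every edge in
    each direction, forces [b * cut_size e A >= k] for every [A] that
    contains [x] but not [y]. *)
Lemma flow_le_cut (T : finType) (e : rel T) (F : T -> T -> nat) (b k : nat)
    (x y : T) (A : {set T}) :
  (forall u v, F u v <= b * e u v) ->
  (forall u, u != x -> u != y -> \sum_v F u v = \sum_v F v u) ->
  \sum_v F x v = k + \sum_v F v x ->
  x \in A -> y \notin A ->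
  k <= b * cut_size e A.
Proof.
move=> capF consF srcF xA yA.
pose cutF := \sum_(u in A) \sum_(v | v \notin A) F u v.
have cutF_le : cutF <= b * cut_size e A.
  rewrite /cut_size big_distrr leq_sum // => u _.
  by rewrite big_distrr leq_sum.
apply: leq_trans cutF_le.
have netF : \sum_(u in A) \sum_v F u v = k + \sum_(u in A) \sum_v F v u.
  rewrite (bigD1 x) //= srcF [in RHS](bigD1 x) //= addnA; congr (_ + _).
  apply: eq_bigr => u /andP[uA u_x]; apply: consF => //.
  by apply: contraNneq yA => <-.
have outF : \sum_(u in A) \sum_v F u v
    = \sum_(u in A) \sum_(v in A) F u v + cutF.
  rewrite -big_split; apply: eq_bigr => u _ /=.
  by rewrite (bigID (mem A)).
have inF : \sum_(u in A) \sum_(v in A) F u v <= \sum_(u in A) \sum_v F v u.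
  rewrite exchange_big leq_sum // => u _.
  by rewrite [X in _ <= X](bigID (mem A)) /= leq_addr.
lia.
Qed.

Section LocalFlow.

Variables (T : finType) (e : rel T).
Hypotheses (symE : symmetric e) (irrE : irreflexive e).
Variables (x y : T) (b : nat).

(** The flow from [x] to [y] along the edge [x]-[y] and its surroundings, scaled
    by [b]: it is [b] on the edges out of [x] and into [y], and 1 on the edges
    from [N(x)] minus [y] to [N(y)] minus [x] that do not lie inside the
    intersection of [N(x)] and [N(y)]. *)
Definition local_flow (u v : T) : nat :=
  e u v * (if (u == x) || (v == y) then b
           else [&& e x u, e y v, u != y, v != x & ~~ (e y u && e x v)]).

Hypothesis exy : e x y.

Lemma local_flow_out u : u != x -> u != y ->
  \sum_v local_flow u v = e u y * b
   + \sum_v ([&& e u v, e x u, e y v, v != x & ~~ (e y u && e x v)] : nat).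
Proof.
move=> u_x u_y; rewrite (bigD1 y) //= [X in _ = _ + X](bigD1 y) //=.
rewrite /local_flow eqxx orbT irrE !andbF add0n; congr (_ + _).
apply: eq_bigr => v v_y; rewrite (negPf u_x) (negPf v_y) u_y /=.
by rewrite mulnb.
Qed.

Lemma local_flow_in u : u != x -> u != y ->
  \sum_v local_flow v u = e x u * b
   + \sum_v ([&& e u v, e y u, e x v, v != y & ~~ (e x u && e y v)] : nat).
Proof.
move=> u_x u_y; rewrite (bigD1 x) //= [X in _ = _ + X](bigD1 x) //=.
rewrite /local_flow eqxx irrE !andbF add0n; congr (_ + _).
apply: eq_bigr => v v_x; rewrite (negPf v_x) (negPf u_y) u_x /=.
rewrite mulnb (symE v u); congr nat_of_bool.
by case: (e u v); case: (e x u); case: (e x v); case: (e y u); case: (e y v);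
   case: (v != y).
Qed.

Lemma codegD1 u w t : e u t -> e w t ->
  codeg e u w = 1 + \sum_v ([&& e u v, e w v & v != t] : nat).
Proof.
move=> ut wt; rewrite /codeg (bigD1 t) //= [in RHS](bigD1 t) //= ut wt eqxx.
by congr (_ + _); apply: eq_bigr => v v_t; rewrite v_t andbT.
Qed.

Lemma codegD1_split u w t : e u t -> e w t -> ~~ e t t ->
  codeg e u w = 1 + (\sum_v ([&& e u v, e w v & e t v] : nat)
    + \sum_v ([&& e u v, e w v, v != t & ~~ e t v] : nat)).
Proof.
move=> ut wt tt; rewrite (codegD1 ut wt) -big_split; congr (_ + _).
apply: eq_bigr => v _ /=; case: eqP => [->|_] /=.
  by rewrite (negPf tt) !andbF.
by case: (e u v); case: (e w v); case: (e t v).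
Qed.

(** The hypotheses say that [local_flow] is conserved at the common neighbours
    of [x] and [y], at the other neighbours of [x], and at the other neighbours
    of [y], in this order. *)
Theorem local_cut_bound (d : nat) (A : {set T}) :
  0 < b ->
  \sum_u (e x u : nat) = d ->
  (forall u, e x u -> e y u -> codeg e u x = codeg e u y) ->
  (forall u, e x u -> ~~ e y u -> u != y -> codeg e u y = b.+1) ->
  (forall u, e y u -> ~~ e x u -> u != x -> codeg e u x = b.+1) ->
  x \in A -> y \notin A -> d <= cut_size e A.
Proof.
move=> b_gt0 degx coE coy cox xA yA; rewrite -(leq_pmul2l b_gt0).
apply: (@flow_le_cut _ e local_flow b (b * d) x y A) => //.
- move=> u v; rewrite /local_flow mulnC leq_mul2r; case: e => //=.
  by case: ifP => // _; case: [&& _, _, _, _ & _].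
- move=> u u_x u_y; rewrite local_flow_out // local_flow_in // (symE u y).
  case ux: (e x u); case uy: (e y u) => /=.
  + have eux: e u x by rewrite symE.
    have euy: e u y by rewrite symE.
    have := coE u ux uy.
    (* The common neighbours of u, x and y are counted on both sides, and so
       is the vertex y, respectively x; they cancel. *)
    rewrite (codegD1_split euy exy) ?irrE // (codegD1_split eux _) ?irrE //;
      last by rewrite symE.
    have -> : \sum_v ([&& e u v, e x v & e y v] : nat)
        = \sum_v ([&& e u v, e y v & e x v] : nat).
      by apply: eq_bigr => v _; rewrite [e x v && _]andbC.
    by move/addnI/addnI => ->.
  + rewrite mul0n mul1n add0n.
    have eux: e u x by rewrite symE.
    have := coy u ux (negbT uy) u_y.
    rewrite (codegD1 eux) 1?symE // add1n => -[E].
    rewrite [X in _ = _ + X]big1 ?addn0; last by move=> v _; rewrite andbF.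
    by rewrite -[RHS]E; apply: eq_bigr => v _; rewrite andbT.
  + rewrite mul0n mul1n add0n.
    have euy: e u y by rewrite symE.
    have := cox u uy (negbT ux) u_x.
    rewrite (codegD1 euy) // add1n => -[E].
    rewrite [X in _ + X = _]big1 ?addn0; last by move=> v _; rewrite andbF.
    by rewrite -[LHS]E; apply: eq_bigr => v _; rewrite andbT.
  + by rewrite !mul0n !big1 // => v _; rewrite !andbF.
- rewrite [X in _ = _ + X]big1 ?addn0; last first.
    move=> v _; rewrite /local_flow eqxx /= !andbF.
    case: eqP => [->|_]; first by rewrite irrE.
    case: eqP => [E|_]; last by rewrite muln0.
    by move: exy; rewrite E irrE.
  rewrite -degx big_distrr /=; apply: eq_bigr => v _.
  by rewrite /local_flow eqxx /= mulnC.
Qed.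

End LocalFlow.

(** * The Tutte-Berge theorem *)

Lemma odd_card_involutive (T : finType) (g : T -> T) (A : {set T}) :
  involutive g -> {in A, forall v, g v \in A} ->
  odd #|[set v in A | g v == v]| = odd #|A|.
Proof.
move=> gK; have [n] := ubnP #|A|; elim: n A => // n IHn A leAn gA.
case: (pickP [pred v in A | g v != v]) => [v /= /andP[vA gv]|noV]; last first.
  congr (odd #|pred_of_set _|); apply/setP => v; rewrite inE.
  by have /= := noV v; case: (v \in A) => //= /negbFE.
pose B := A :\ v :\ g v.
have cardA : #|A| = #|B|.+2.
  by rewrite (cardsD1 v) vA (cardsD1 (g v)) !inE gv gA.
have -> : [set v0 in A | g v0 == v0] = [set v0 in B | g v0 == v0].
  apply/setP => w; rewrite !inE.
  have [->|_] := eqVneq w v; first by rewrite (negPf gv) !andbF.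
  have [->|_] := eqVneq w (g v); last by [].
  by rewrite gK eq_sym (negPf gv) !andbF.
rewrite cardA /= negbK; apply: IHn; first by rewrite cardA in leAn; lia.
move=> w; rewrite !inE => /and3P[w_gv w_v wA].
by rewrite gA // (inj_eq (can_inj gK)) w_v (can2_eq gK gK) w_gv.
Qed.

Section Berge.

Variables (T : finType) (e : rel T).
Hypotheses (symE : symmetric e) (irrE : irreflexive e).

Implicit Types (U S : {set T}) (P : {set {set T}}) (m : {ffun T -> T}).

(** A matching inside [U], encoded as the involution that exchanges the ends of
    each of its edges and fixes the other vertices. *)
Definition is_matching (U : {set T}) (m : {ffun T -> T}) : bool :=
  [forall v, (m (m v) == v) && ((m v != v) ==> (v \in U) && e v (m v))].

(** The vertices of [U] not covered by the matching. *)
Definition missed (U : {set T}) (m : {ffun T -> T}) : {set T} :=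
  [set v in U | m v == v].

Lemma matchingK U m : is_matching U m -> involutive m.
Proof. by move=> /forallP mP v; have /andP[/eqP] := mP v. Qed.

Lemma matching_edge U m v : is_matching U m -> m v != v ->
  [/\ v \in U, m v \in U & e v (m v)].
Proof.
move=> mM mv; have mK := matchingK mM; move/forallP: mM => mP.
have /andP[_ /implyP/(_ mv)/andP[vU evm]] := mP v.
split=> //; have /andP[_ /implyP] := mP (m v).
by rewrite mK eq_sym => /(_ mv)/andP[].
Qed.

Lemma matchingP U m : involutive m ->
  (forall v, m v != v -> v \in U /\ e v (m v)) -> is_matching U m.
Proof.
move=> mK mE; apply/forallP => v; rewrite mK eqxx /=.
by apply/implyP => /mE[-> ->].
Qed.

Lemma odd_missed U m : is_matching U m -> odd #|missed U m| = odd #|U|.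
Proof.
move=> mM; apply: odd_card_involutive; first exact: matchingK mM.
move=> v vU; have [->//|mv] := eqVneq (m v) v.
by have [] := matching_edge mM mv.
Qed.

(** Given a vertex [x] missed by [m], replaces the edge of [m] at [y], if any,
    by the edge [x]-[y]. *)
Definition add_edge (m : {ffun T -> T}) (x y : T) : {ffun T -> T} :=
  [ffun z => if z == x then y else if z == y then x
             else if z == m y then z else m z].

Section AddEdge.

Variables (U : {set T}) (m : {ffun T -> T}) (x y : T).
Hypotheses (mM : is_matching U m) (mx : m x = x) (exy : e x y).
Hypotheses (xU : x \in U) (yU : y \in U).

Let x_y : x != y. Proof. by apply: contraTneq exy => ->; rewrite irrE. Qed.

Lemma add_edge_matching : is_matching U (add_edge m x y).
Proof.
have mK := matchingK mM; apply: matchingP => [z|z]; rewrite !ffunE.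
  have [->|zx] := eqVneq z x; first by rewrite eqxx eq_sym (negPf x_y).
  have [->|zy] := eqVneq z y; first by rewrite eqxx.
  have [E|zmy] := eqVneq z (m y).
    by rewrite (negPf zx) (negPf zy) E eqxx.
  rewrite -{1}mx (inj_eq (can_inj mK)) (negPf zx) -{1}(mK y).
  by rewrite !(inj_eq (can_inj mK)) (negPf zmy) (negPf zy) mK.
have [->|zx] := eqVneq z x; first by [].
have [->|zy] := eqVneq z y; first by rewrite symE.
have [E|zmy] := eqVneq z (m y); first by rewrite eqxx.
by move=> mz; have [] := matching_edge mM mz.
Qed.

Lemma missed_add_edge :
  missed U (add_edge m x y) \subset m y |: (missed U m :\ x).
Proof.
apply/subsetP => z; rewrite !inE ffunE => /andP[->].
have [->|zx] := eqVneq z x; first by rewrite eq_sym (negPf x_y).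
have [->|zy] := eqVneq z y; first by rewrite (negPf x_y).
by have [->|zmy //] := eqVneq z (m y).
Qed.

Lemma card_missed_add_edge :
  #|missed U (add_edge m x y)| <= #|missed U m|.
Proof.
apply: leq_trans (subset_leq_card missed_add_edge) _.
rewrite [leqRHS](cardsD1 x) inE xU mx eqxx /= cardsU1.
by rewrite leq_add2r leq_b1.
Qed.

Lemma card_missed_add_edge_lt : m y = y ->
  #|missed U (add_edge m x y)| < #|missed U m|.
Proof.
move=> my; rewrite [ltnRHS](cardsD1 x) inE xU mx eqxx /= ltnS.
apply: subset_leq_card; apply/subsetP => z zM.
have /(subsetP missed_add_edge) := zM; rewrite my !inE.
case/orP => // /eqP zy; move: zM; rewrite zy inE ffunE (eq_sym y x) (negPf x_y).
by rewrite eqxx (negPf x_y) andbF.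
Qed.

End AddEdge.

(** A matching inside [U] of maximum size. *)
Definition is_maximum (U : {set T}) (m : {ffun T -> T}) : bool :=
  is_matching U m &&
  [forall m' : {ffun T -> T},
     is_matching U m' ==> (#|missed U m| <= #|missed U m'|)].

Lemma maximum_matching U m : is_maximum U m -> is_matching U m.
Proof. by case/andP. Qed.

Lemma maximum_min U m m' : is_maximum U m -> is_matching U m' ->
  #|missed U m| <= #|missed U m'|.
Proof. by case/andP => _ /forallP/(_ m')/implyP H /H. Qed.

Lemma maximumP U m :
  is_matching U m ->
  (forall m', is_matching U m' -> #|missed U m| <= #|missed U m'|) ->
  is_maximum U m.
Proof.
by move=> mM mmin; rewrite /is_maximum mM; apply/forallP => m'; apply/implyP/mmin.
Qed.

Lemma maximum_exists U : exists m, is_maximum U m.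
Proof.
pose m1 : {ffun T -> T} := [ffun z => z].
have m1M : is_matching U m1.
  by apply: matchingP => v; rewrite !ffunE // eqxx.
have [m mM mmin] := arg_minnP (fun m => #|missed U m|) m1M.
by exists m; apply: maximumP.
Qed.

(** [u] and [v] are equal or no maximum matching misses both.  When every vertex
    is missed by some maximum matching, this is an equivalence relation, and its
    classes are the odd parts sought. *)
Definition gallai_rel (U : {set T}) (u v : T) : bool :=
  (u == v) ||
  [forall m, is_maximum U m ==> ~~ ((m u == u) && (m v == v))].

Lemma gallai_relP U u v :
  reflect (u = v \/ forall m, is_maximum U m -> m u = u -> m v = v -> False)
          (gallai_rel U u v).
Proof.
apply: (iffP orP) => -[/eqP|H]; [by left| |by left|]; right.
  move=> m mM mu mv; move/forallP: H => /(_ m)/implyP/(_ mM).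
  by rewrite mu mv !eqxx.
apply/forallP => m; apply/implyP => mM; apply/negP => /andP[/eqP mu /eqP mv].
exact: H mM mu mv.
Qed.

Lemma gallai_rel_refl U u : gallai_rel U u u.
Proof. by rewrite /gallai_rel eqxx. Qed.

Lemma gallai_rel_sym U u v : gallai_rel U u v = gallai_rel U v u.
Proof.
rewrite /gallai_rel eq_sym; congr (_ || _); apply: eq_forallb => m.
by rewrite andbC.
Qed.

Lemma gallai_rel_edge U u v :
  u \in U -> v \in U -> e u v -> gallai_rel U u v.
Proof.
move=> uU vU euv; apply/gallai_relP; right => m mM mu mv.
have mm := maximum_matching mM.
have := card_missed_add_edge_lt mu euv uU mv.
by rewrite ltnNge (maximum_min mM) // add_edge_matching.
Qed.

(** Transitivity, the core of Gallai's lemma.  Suppose that a maximum matching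
    [m] misses [u] and [v].  Among the maximum matchings missing [t], take [n]
    with as many edges as possible in common with [m].  As [n] covers [u] and
    [v], it misses another vertex [x] besides [t] that [m] covers, and putting
    the edge of [m] at [x] into [n] increases the agreement. *)
Lemma gallai_rel_trans U u t v :
  u \in U -> t \in U -> v \in U ->
  (exists2 m, is_maximum U m & m t = t) ->
  gallai_rel U u t -> gallai_rel U t v -> gallai_rel U u v.
Proof.
move=> uU tU vU [n0 n0M n0t] Rut Rtv; apply/gallai_relP.
have [->|u_v] := eqVneq u v; [by left | right] => m mM mu mv.
have u_t : u != t.
  by apply: contraNneq u_v => E; move: Rtv; rewrite -E => /gallai_relP[->//|];
     move/(_ m mM mu mv).
have v_t : v != t.
  by apply: contraNneq u_v => E; move: Rut; rewrite -E => /gallai_relP[->//|];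
     move/(_ m mM mu mv).
have mt : m t != t.
  apply/eqP => mt; have /gallai_relP[/eqP|] := Rut; first by rewrite (negPf u_t).
  by move/(_ m mM mu mt).
pose agree (n : {ffun T -> T}) := [set z | (m z != z) && (n z == m z)].
pose missing_t (n : {ffun T -> T}) := is_maximum U n && (n t == t).
have n0P : missing_t n0 by rewrite /missing_t n0M n0t eqxx.
have [n /andP[nM /eqP nt] nmax] := @arg_maxnP _ n0 missing_t (fun n => #|agree n|) n0P.
have nu : n u != u.
  apply/eqP => nu; have /gallai_relP[/eqP|] := Rut; first by rewrite (negPf u_t).
  by move/(_ n nM nu nt).
have nv : n v != v.
  apply/eqP => nv; have /gallai_relP[/eqP|] := Rtv.
    by rewrite eq_sym (negPf v_t).
  by move/(_ n nM nt nv).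
have mm := maximum_matching mM; have nm := maximum_matching nM.
have mK := matchingK mm; have nK := matchingK nm.
have [x] : exists x, x \in (missed U n :\: missed U m) :\ t.
  apply/set0Pn; rewrite -card_gt0.
  have : #|missed U n :\: missed U m| = #|missed U m :\: missed U n|.
    have E : #|missed U n| = #|missed U m|.
      by apply/eqP; rewrite eqn_leq !maximum_min.
    apply/eqP; rewrite -(eqn_add2l #|missed U n :&: missed U m|) cardsID setIC.
    by rewrite cardsID E.
  rewrite (cardsD1 t) (cardsD1 u (missed U m :\: _)) (cardsD1 v (_ :\ u)).
  rewrite !inE tU nt eqxx mt /=.
  by rewrite uU vU mu mv !eqxx /= nu nv (eq_sym v u) u_v !add1n => -[->].
rewrite !inE => /and3P[x_t mx /andP[xU /eqP nx]]; rewrite xU /= in mx.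
have [_ yU exy] := matching_edge mm mx.
set y := m x in mx yU exy.
(* Otherwise the edge x-y could be added to the maximum matching n. *)
have ny : n y != y.
  apply/eqP => ny; have := card_missed_add_edge_lt nx exy xU ny.
  by rewrite ltnNge (maximum_min nM) // add_edge_matching.
have n'M : is_maximum U (add_edge n x y).
  apply: maximumP => [|m' m'M]; first exact: add_edge_matching.
  apply: leq_trans (maximum_min nM m'M).
  exact: card_missed_add_edge.
have n't : add_edge n x y t = t.
  rewrite ffunE eq_sym (negPf x_t).
  have [E|_] := eqVneq t y; first by rewrite -E nt eqxx in ny.
  by case: ifP.
have := nmax (add_edge n x y); rewrite /missing_t n'M n't eqxx => /(_ isT).
apply/negP; rewrite -ltnNge; apply: proper_card; apply/properP; split.
  apply/subsetP => z; rewrite !inE ffunE => /andP[mz /eqP nz].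
  rewrite mz /=; have [->//|z_x] := eqVneq z x.
  have [zy|z_y] := eqVneq z y; first by rewrite zy /y mK.
  have [E|_] := eqVneq z (n y); last by rewrite nz.
  (* Here m and n would agree at n y, so that n y = m y = x. *)
  move: nz z_x; rewrite {1}E nK /y => /(can_inj mK) ->.
  by rewrite eqxx.
(* The agreement is strictly larger: it now contains x. *)
exists x; first by rewrite inE ffunE eqxx mx eqxx.
by rewrite inE nx negb_and orbC eq_sym mx.
Qed.

(** [P] splits [U] minus [S] into parts of odd size with no edges between
    different parts. *)
Definition odd_separation (U S : {set T}) (P : {set {set T}}) : Prop :=
  [/\ partition P (U :\: S),
      forall C, C \in P -> odd #|C| &
      forall C u v, C \in P -> u \in C -> v \in U :\: S -> e u v -> v \in C].

(** If every vertex of [U] is missed by some maximum matching, then [U] splits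
    into odd parts without edges between them, and a maximum matching misses at
    most one vertex of each: the parts are the classes of [gallai_rel]. *)
Lemma gallai_lemma U m0 :
  (forall v, v \in U -> exists2 m, is_maximum U m & m v = v) ->
  is_maximum U m0 ->
  exists2 P, odd_separation U set0 P & #|missed U m0| <= #|P|.
Proof.
move=> allmiss m0M; pose R := gallai_rel U.
have Rtr u t v : u \in U -> t \in U -> v \in U -> R u t -> R t v -> R u v.
  by move=> uU tU vU; apply: gallai_rel_trans => //; apply: allmiss.
have Req : {in U & &, equivalence_rel R}.
  move=> u v w uU vU wU; split; first exact: gallai_rel_refl.
  move=> Ruv; apply/idP/idP; last exact: Rtr.
  by apply: Rtr => //; rewrite /R gallai_rel_sym.
pose P := equivalence_partition R U.
pose cl x := [set y in U | R x y].
have PP C : C \in P -> exists2 x, x \in U & C = cl x by case/imsetP => x; exists x.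
have closedC x u v : x \in U -> u \in cl x -> v \in U -> e u v -> v \in cl x.
  move=> xU; rewrite !inE => /andP[uU Rxu] vU euv; rewrite vU.
  by apply: Rtr Rxu _ => //; apply: gallai_rel_edge.
exists P.
  split; rewrite ?setD0; first exact: equivalence_partitionP.
    move=> C /PP[x xU ->]; have [m mM mx] := allmiss x xU.
    have mm := maximum_matching mM.
    rewrite -(odd_card_involutive (matchingK mm)) => [|v vC]; last first.
      have [->//|mv] := eqVneq (m v) v.
      by have [_ mvU emv] := matching_edge mm mv; apply: closedC vC _ _.
    suff -> : [set v in cl x | m v == v] = [set x] by rewrite cards1.
    apply/setP => v; rewrite !inE; apply/andP/eqP => [[/andP[vU]]|->].
      move=> /gallai_relP[//|H] /eqP mv; first by case: (H m mM mx mv).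
    by rewrite mx eqxx xU /R gallai_rel_refl.
  by move=> C u v /PP[x xU ->] uC; apply: closedC.
have clinj : {in missed U m0 &, injective cl}.
  move=> u v; rewrite !inE => /andP[uU /eqP mu] /andP[vU /eqP mv] E.
  have : v \in cl u by rewrite E inE vU /R gallai_rel_refl.
  rewrite inE vU => /gallai_relP[//|H].
  by case: (H m0 m0M mu mv).
rewrite -(card_in_imset clinj); apply: subset_leq_card; apply/subsetP => C.
by case/imsetP => x; rewrite inE => /andP[xU _] ->; apply: imset_f.
Qed.

(** The Tutte-Berge theorem inside [U], in the direction that produces a
    separation certifying the size of a matching. *)
Theorem berge (U : {set T}) :
  exists m S P, [/\ is_matching U m, S \subset U, odd_separation U S P
    & #|missed U m| + #|S| <= #|P|].
Proof.
have [n] := ubnP #|U|; elim: n U => // n IHn U leUn.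
have [m0 m0M] := maximum_exists U; have m0m := maximum_matching m0M.
case: (boolP [forall v in U, exists m, is_maximum U m && (m v == v)]) => [allm|].
  have [||P sepP leP] := @gallai_lemma U m0 => //.
    by move=> v vU; have /existsP[m /andP[? /eqP ?]] := forall_inP allm v vU; exists m.
  by exists m0, set0, P; rewrite cards0 addn0 sub0set.
case/forall_inPn => v vU /existsPn vcov.
have [|m [S [P [mm SU [partP oddP clP] leP]]]] := IHn (U :\ v).
  by rewrite (cardsD1 v) vU in leUn.
have vS : v \notin S.
  by apply: contraTN SU => vS; apply/subsetPn; exists v; rewrite // !inE eqxx.
have mmU : is_matching U m.
  apply: matchingP (matchingK mm) _ => w mw.
  by have [] := matching_edge mm mw; rewrite !inE => /andP[].
have mv : m v = v.
  by apply/eqP/negPn/negP => /(matching_edge mm)[]; rewrite !inE eqxx.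
have cardm : #|missed U m| = #|missed (U :\ v) m|.+1.
  rewrite (cardsD1 v) inE vU mv eqxx /= add1n; congr _.+1.
  by apply: eq_card => w; rewrite !inE andbA.
have lt0 : #|missed U m0| < #|missed U m|.
  rewrite ltnNge; apply/negP => le; have := vcov m; rewrite mv eqxx andbT.
  case/negP; apply: maximumP => // m' m'm.
  exact: leq_trans le (maximum_min m0M m'm).
(* By parity, m0 misses at least two vertices fewer than m. *)
have par : odd #|missed U m0| = odd #|missed U m| by rewrite !odd_missed.
have DE : U :\: (v |: S) = (U :\ v) :\: S.
  by apply/setP => w; rewrite !inE negb_or andbA [_ && (w \notin S)]andbC.
exists m0, (v |: S), P; split=> //.
- rewrite subUset sub1set vU; apply: subset_trans SU _; exact: subsetDl.
- by split; rewrite ?DE.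
- by rewrite cardsU1 vS; lia.
Qed.

End Berge.

(** In a finite graph with an even number of vertices and degrees at most [d],
    some matching covers [F] as soon as at least [d] edges leave each nonempty
    proper subset of [F]. *)
Lemma even_cut_cover (T : finType) (a : rel T) (F : {set T}) (d : nat) :
  symmetric a -> irreflexive a -> ~~ odd #|T| -> 0 < d ->
  (forall v, \sum_u (a v u : nat) <= d) ->
  (forall C : {set T}, C \subset F -> C != set0 -> C != setT ->
     d <= cut_size a C) ->
  exists2 m : T -> T, involutive m & forall v, v \in F -> a v (m v).
Proof.
move=> symA irrA evenT d_gt0 degA cutA.
(* Vertices outside F are made pairwise adjacent, as they need not be covered
   by edges of a. *)
pose e u v := a u v || [&& u != v, u \notin F & v \notin F].
have symE : symmetric e.
  by move=> u v; rewrite /e symA eq_sym [(u \notin F) && _]andbC.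
have irrE : irreflexive e by move=> u; rewrite /e irrA eqxx.
have [m [S [P [mM _ [partP oddP clP] leP]]]] := berge symE irrE setT.
have mK := matchingK mM.
have [m0|missed_gt0] := posnP #|missed setT m|.
  exists m => // v vF; have mv : m v != v.
    apply/eqP => mv; have : v \in missed setT m by rewrite !inE mv eqxx.
    by rewrite (cards0_eq m0) inE.
  by have [_ _] := matching_edge mM mv; rewrite /e vF andbF orbF.
have missed_ge2 : 2 <= #|missed setT m|.
  have := odd_missed mM; rewrite cardsT (negPf evenT).
  by case: #|missed setT m| missed_gt0 => [|[|]].
have /and3P[/eqP covP /trivIsetP trivP n0P] := partP.
have clPS C u v : C \in P -> u \in C -> v \notin S -> e u v -> v \in C.
  by move=> CP uC vS; apply: clP => //; rewrite !inE vS.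
have uniqP C C' u : C \in P -> C' \in P -> u \in C -> u \in C' -> C = C'.
  move=> CP C'P uC uC'; apply/eqP/negPn/negP => /(trivP _ _ CP C'P).
  by move/pred0P/(_ u); rewrite /= uC uC'.
have notinS C u : C \in P -> u \in C -> u \notin S.
  move=> CP uC; have : u \in cover P by apply/bigcupP; exists C.
  by rewrite covP !inE andbT.
pose P' := [set C in P | C \subset F].
(* At most one part leaves F: two such parts would be joined by an edge of e. *)
have cardP' : #|S| < #|P'|.
  have : #|P :\: P'| <= 1.
    apply/card_le1_eqP => C C'; rewrite !inE => /andP[+ CP] /andP[+ C'P].
    rewrite CP C'P /= => /subsetPn[u uC uF] /subsetPn[u' uC' uF'].
    have [E|u_u'] := eqVneq u u'; first by apply: (uniqP _ _ u) => //; rewrite E.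
    apply: (uniqP _ _ u') => //; apply: (clPS C u) => //; first exact: notinS uC'.
    by rewrite /e u_u' uF uF' orbT.
  have := cardsID P' P; have -> : P :&: P' = P'.
    by apply/setIidPr/subsetP => C; rewrite inE => /andP[].
  by lia.
have cutP' C : C \in P' -> d <= \sum_(u in C) \sum_(v in S) (a u v : nat).
  rewrite inE => /andP[CP CF].
  apply: leq_trans (cutA C CF _ _) _; first by apply: contraTneq CP => ->.
    have : 0 < #|P :\ C| by have := cardsD1 C P; rewrite CP; lia.
    case/card_gt0P => C'; rewrite !inE => /andP[C'C C'P].
    have /set0Pn[u uC'] : C' != set0 by apply: contraNneq n0P => <-.
    apply: contraNneq C'C => CT; apply/eqP; apply: (uniqP _ _ u) => //.
    by rewrite CT inE.
  apply: leq_sum => u uC; rewrite [leqRHS]big_mkcond [leqLHS]big_mkcond.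
  apply: leq_sum => v _; case: ifP => // vC; case: ifP => // /negbT vS.
  rewrite leqn0 eqb0; apply: contra vC => auv.
  by apply: (clPS C u) => //; rewrite /e auv.
(* Double counting of the edges between S and the parts. *)
have up : \sum_(C in P) \sum_(u in C) \sum_(v in S) (a u v : nat) <= d * #|S|.
  rewrite -(big_trivIset _ _) /=; last by case/and3P: partP.
  apply: (@leq_trans (\sum_u \sum_(v in S) (a u v : nat))).
    by rewrite [leqRHS](bigID (mem (cover P))) leq_addr.
  rewrite exchange_big /= mulnC -sum_nat_const leq_sum // => v _.
  by under eq_bigr => u _ do rewrite symA.
have : d * #|P'| <= d * #|S|.
  apply: leq_trans up; rewrite mulnC -sum_nat_const.
  apply: (@leq_trans (\sum_(C in P') \sum_(u in C) \sum_(v in S) (a u v : nat))).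
    exact: leq_sum.
  rewrite [leqRHS](bigID (mem P')) /= [X in _ <= X + _](eq_bigl (mem P')).
    by rewrite leq_addr.
  by move=> C; rewrite /= !inE; case: (C \in P).
by rewrite leq_pmul2l // leqNgt cardP'.
Qed.

From mathcomp Require Import boolp classical_sets functions cardinality filter.

Local Open Scope classical_set_scope.
Local Open Scope card_scope.

(** * Counting along a finite injection *)

Lemma card_sum_asbool (T : finType) (B : set T) :
  B #= `I_(\sum_i (`[<B i>] : nat)).
Proof.
pose D := [pred i | `[<B i>]].
have -> : \sum_i (`[<B i>] : nat) = #|D|.
  rewrite -sum1_card [RHS]big_mkcond; apply: eq_bigr => i _.
  by rewrite inE; case: (asbool _).
have defB : B = [set enum_val x | x in [set: 'I_#|D|]].
  apply/seteqP; split=> [i Bi|_ [x _ <-]].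
    have Di : i \in D by apply/asboolP.
    by exists (enum_rank_in Di i) => //; rewrite enum_rankK_in.
  by have /asboolP := enum_valP x.
rewrite [X in X #= _]defB.
apply: card_eq_trans (inj_card_eq _) _; first by move=> x y _ _; apply: enum_val_inj.
by rewrite card_eq_sym; apply: card_II.
Qed.

Section Preimage.
Variables (V : Type) (n : nat) (f : 'I_n -> V).
Hypothesis f_inj : injective f.

Lemma card_preimage_inj (A : set V) :
  A `&` range f #= `I_(\sum_i (`[<A (f i)>] : nat)).
Proof.
apply: card_eq_trans (card_sum_asbool (fun i => A (f i))).
have -> : A `&` range f = [set f i | i in [set i | A (f i)]].
  by apply/seteqP; split=> [x [Ax [i _ fi]]|_ [i Ai <-]];
    [by exists i => //=; rewrite fi | by split=> //; exists i].
by apply: inj_card_eq => i j _ _; apply: f_inj.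
Qed.

Lemma sum_preimage_le (A : set V) (k : nat) :
  A #= `I_k -> \sum_i (`[<A (f i)>] : nat) <= k.
Proof.
move=> Ak; rewrite -card_le_II.
have := card_preimage_inj A; rewrite card_eq_le => /andP[_ le].
apply: card_le_trans le _; apply: card_le_trans (subset_card_le (@subIsetl _ _ _)) _.
by move: Ak; rewrite card_eq_le => /andP[].
Qed.

Lemma sum_preimage_eq (A : set V) (k : nat) :
  A `<=` range f -> A #= `I_k -> \sum_i (`[<A (f i)>] : nat) = k.
Proof.
move=> /setIidl Af Ak; apply/esym/card_eq_II.
have := card_preimage_inj A; rewrite Af; apply: card_eq_trans.
by rewrite card_eq_sym.
Qed.

End Preimage.

(** * Amply regular graphs *)

Lemma walk_exit (G : sgraph) (A : set G) k (u v : G) :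
  walk k u v -> A u -> ~ A v -> exists p q, [/\ A p, ~ A q & adj p q].
Proof.
elim: k u => [u /= -> //|k IHk u /= [z uz zv] Au nAv].
have [Az|nAz] := pselect (A z); first exact: IHk zv Az nAv.
by exists u, z.
Qed.

Lemma at_distance2 (G : sgraph) (x y z : G) :
  adj x z -> adj z y -> x <> y -> ~ adj x y -> at_distance 2 x y.
Proof.
move=> xz zy x_y nxy; split; first by exists z => //; exists y.
by case=> [|[|//]] _ //= [t xt ty]; apply: nxy; rewrite -ty.
Qed.

Lemma degree_gt0 (G : sgraph) d :
  @regular G d -> ~ @edgeless G -> 0 < d.
Proof.
move=> regG nedge; rewrite lt0n; apply/eqP => d0; apply: nedge => x y xy.
have := regG x; rewrite d0 II0 card_eq0 => /eqP N0.
by have : neighbors x y by []; rewrite N0.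
Qed.

(** [R] contains every vertex at distance at most two from [x]. *)
Definition radius2_in (G : sgraph) (R : set G) (x : G) : Prop :=
  R x /\ forall y, adj x y -> R y /\ neighbors y `<=` R.

Section Interior.

Variables (G : sgraph) (d alpha beta : nat).
Hypotheses (connG : connected_graph G) (ampG : amply_regular G d alpha beta).
Hypothesis beta_gt1 : 1 < beta.
Variables (n : nat) (f : 'I_n -> G).
Hypothesis f_inj : injective f.

(* The subgraph of G induced on the range of f. *)
Let a (i j : 'I_n) : bool := `[<adj (f i) (f j)>].

Let symA : symmetric a.
Proof. by move=> i j; apply/asboolP/asboolP; apply: adj_sym. Qed.

Let irrA : irreflexive a.
Proof. by move=> i; apply/asboolP; apply: adj_irrefl. Qed.

Lemma codeg_common i j k :
  neighbors (f j) `<=` range f -> common_neighbors (f i) (f j) #= `I_k ->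
  codeg a i j = k.
Proof.
move=> Nj /(sum_preimage_eq f_inj) <-; last by move=> z [_ /Nj].
by apply: eq_bigr => u _; rewrite asbool_and.
Qed.

(** At least [d] edges leave [C], already within the range of [f]: by
    connectedness [C] is left by an edge [x]-[y], and the neighbourhoods of [x]
    and [y] lie in the range, so that [local_cut_bound] applies. *)
Lemma interior_cut_bound (C : {set 'I_n}) :
  (forall i, i \in C -> radius2_in (range f) (f i)) ->
  C != finset.set0 -> C != [set: 'I_n]%SET ->
  d <= cut_size a C.
Proof.
move=> intC /finset.set0Pn[u uC] CT.
have [regG _ nedge adjG disG] := ampG.
have [v vC] : exists v, v \notin C.
  apply/existsP; apply: contraNT CT => /existsPn H.
  by apply/eqP/finset.setP => i; rewrite inE; have := H i; rewrite negbK.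
have [k] := connG (f u) (f v).
case/(@walk_exit _ [set f i | i in [set i | i \in C]]).
- by exists u.
- by case=> i /= iC /f_inj E; rewrite -E iC in vC.
move=> p [q [[x /= xC <-] nq xq]].
have [_ intx] := intC x xC.
have [[y _ yq] Nq] := intx q xq; rewrite -{q}yq in nq xq Nq *.
have yC : y \notin C by apply/negP => yC; apply: nq; exists y.
have Nx : neighbors (f x) `<=` range f by move=> z /intx[].
have axy : a x y by apply/asboolP.
apply: (@local_cut_bound _ a symA irrA x y beta.-1 axy) => //.
- by rewrite -ltnS prednK // ltnW.
- exact: sum_preimage_eq (regG (f x)).
- move=> w /asboolP xw /asboolP yw.
  by rewrite !(@codeg_common _ _ alpha) //; apply: adjG; apply: adj_sym.
- move=> w /asboolP xw /asboolP nyw w_y; rewrite prednK ?(ltnW beta_gt1) //.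
  apply: codeg_common => //; apply: disG; apply: (@at_distance2 _ _ _ (f x)) => //.
  + exact: adj_sym.
  + by move/f_inj => E; rewrite E eqxx in w_y.
  + by move/adj_sym.
- move=> w /asboolP yw /asboolP nxw w_x; rewrite prednK ?(ltnW beta_gt1) //.
  apply: codeg_common => //; apply: disG; apply: (@at_distance2 _ _ _ (f y)) => //.
  + exact: adj_sym.
  + exact: adj_sym.
  + by move/f_inj => E; rewrite E eqxx in w_x.
  + by move/adj_sym.
Qed.

Lemma interior_matching (F : set G) :
  ~~ odd n -> (forall x, F x -> radius2_in (range f) x) ->
  exists m : G -> G, forall x, F x -> adj x (m x) /\ m (m x) = x.
Proof.
move=> evenn intF; have [regG _ nedge _ _] := ampG.
pose FI := finset.finset (fun i => `[<F (f i)>]).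
have [||||t tK tF] := @even_cut_cover _ a FI d symA irrA.
- by rewrite card_ord.
- exact: degree_gt0 regG nedge.
- by move=> i; apply: (sum_preimage_le f_inj (regG (f i))).
- move=> C /fintype.subsetP CF; apply: interior_cut_bound => i /CF.
  by rewrite inE => /asboolP/intF.
have /choice[m mE] : forall x, exists y, forall i, f i = x -> y = f (t i).
  move=> x; have [[i fi]|nf] := pselect (exists i, f i = x).
    by exists (f (t i)) => j; rewrite -fi => /f_inj ->.
  by exists x => i fi; case: nf; exists i.
exists m => x Fx; have [[i _ fi] _] := intF x Fx.
rewrite (mE x i fi) (mE _ (t i) erefl) tK; split=> //.
rewrite -[X in adj X]fi; apply/asboolP; apply: tF.
by rewrite inE; apply/asboolP; rewrite fi.
Qed.

End Interior.

(** * From finite to infinite graphs *)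

Lemma enum_card (V : Type) (A : set V) (k : nat) :
  A #= `I_k -> exists2 f : 'I_k -> V, injective f & A = range f.
Proof.
rewrite card_eq_sym => Ak.
have TA : [set: 'I_k] #= A by apply: card_eq_trans Ak; rewrite card_eq_sym card_II.
have /card_bijP[g [h gK hK]] := TA.
pose i0 (i : 'I_k) : [set: 'I_k] := SigSub (mem_set (I : [set: 'I_k] i)).
exists (fun i => val (g (i0 i))) => [i j /val_inj/(can_inj gK)[]//|].
apply/seteqP; split=> [x Ax|_ [i _ <-]]; last exact/set_mem/(valP (g _)).
pose y : A := SigSub (mem_set Ax); exists (val (h y)) => //.
by have -> : i0 (val (h y)) = h y; [apply: val_inj | rewrite hK].
Qed.

Lemma enum_even_superset (V : Type) (W : set V) :
  (exists2 n, ~~ odd n & [set: V] #= `I_n) \/ infinite_set [set: V] ->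
  finite_set W ->
  exists n (f : 'I_n -> V), [/\ ~~ odd n, injective f & W `<=` range f].
Proof.
case=> [[n evenn Vn] _|infV finW].
  have [f f_inj E] := enum_card Vn; exists n, f; split=> //.
  by rewrite -E.
have /finite_setP[n Wn] := finW.
have [even|odd_n] := boolP (~~ odd n).
  by have [f f_inj E] := enum_card Wn; exists n, f; split=> //; rewrite E.
have [x [_ nWx]] := infinite_setN0 (infinite_setD infV finW).
have [|f f_inj E] := @enum_card _ (x |` W) n.+1.
  apply/eq_cardSP; exists x; first by left.
  suff -> : (x |` W) `\ x = W by [].
  apply/seteqP; split=> [y [[->|//] []]//|y Wy]; split; first by right.
  by move=> /= yx; apply: nWx; rewrite -yx.
exists n.+1, f; split=> //; by rewrite -E => y; right.
Qed.

(** An ultrafilter that contains a finite union contains one of its members. *)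
Lemma ultra_exists_lt (I : Type) (U : set_system I) (Q : nat -> set I) k :
  UltraFilter U -> U [set t | exists2 i, i < k & Q i t] ->
  exists2 i, i < k & U (Q i).
Proof.
move=> UU; elim: k => [|k IHk] Uk.
  have [nU0 _] := @ultra_proper _ _ UU; case: nU0.
  by have -> : set0 = [set t | exists2 i, i < 0 & Q i t] by apply/seteqP; split=> // t [].
have [Qk|nQk] := in_ultra_setVsetC (Q k) UU; first by exists k.
have [|i ik Qi] := IHk; last by exists i => //; apply: ltnW.
have [_ FU] := @ultra_proper _ _ UU.
apply: filterS (filterI Uk nQk) => t [[i ik Qi] nQ].
exists i => //; move: ik; rewrite ltnS leq_eqVlt => /orP[/eqP E|//].
by case: nQ; rewrite -E.
Qed.

(** Partial matchings covering the finite sets yield a matching covering all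
    vertices: as neighbourhoods are finite, the partner of each vertex has a
    limit along an ultrafilter refining inclusion of finite sets. *)
Lemma matching_compactness (G : sgraph) :
  locally_finite G ->
  (forall F : set G, finite_set F ->
    exists m : G -> G, forall x, F x -> adj x (m x) /\ m (m x) = x) ->
  exists m : G -> G, forall x, adj x (m x) /\ m (m x) = x.
Proof.
move=> lfG locm.
have /choice[m mP] : forall F : set G, exists m : G -> G,
    finite_set F -> forall x, F x -> adj x (m x) /\ m (m x) = x.
  move=> F; have [/locm[m mP]|nF] := pselect (finite_set F); first by exists m.
  by exists id.
pose B : set_system (set G) := [set X | exists2 F0, finite_set F0 &
  forall F, finite_set F -> F0 `<=` F -> X F].
have BF : ProperFilter B.
  split; first by case=> F0 finF0 /(_ F0 finF0); apply.
  split.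
  - by exists set0.
  - move=> X Y [F1 fin1 X1] [F2 fin2 Y2]; exists (F1 `|` F2).
      by rewrite finite_setU.
    move=> F finF sF; split; [apply: X1 | apply: Y2] => // z Fz; apply: sF.
      by left.
    by right.
  - by move=> X Y XY [F0 fin0 X0]; exists F0 => // F finF sF; apply/XY/X0.
have [U [UU BU]] := ultraFilterLemma BF.
have [nU0 FU] := @ultra_proper _ _ UU.
have Ux x : U [set F | adj x (m F x) /\ m F (m F x) = x].
  apply: BU; exists [set x]; first exact: finite_set1.
  by move=> F finF xF; apply: mP => //; apply: xF.
have /choice[mu muP] : forall x, exists y, U [set F | m F x = y].
  move=> x; have /finite_setP[k /enum_card[g _ gN]] := lfG x.
  pose Q i := [set F | exists2 j : 'I_k, val j = i & m F x = g j].
  have [|i ik Qi] := @ultra_exists_lt _ U Q k UU.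
    apply: filterS (Ux x) => F [adjx _].
    have : neighbors x (m F x) by []; rewrite gN => -[j _ gj].
    by exists (val j); [exact: ltn_ord | exists j].
  exists (g (Ordinal ik)); apply: filterS Qi => F [j ji /= ->].
  by congr g; apply: val_inj.
exists mu => x.
have UI X Y : U X -> U Y -> U (X `&` Y) by exact: filterI.
have Uxy := UI _ _ (UI _ _ (Ux x) (muP x)) (muP (mu x)).
have [F [[[adjx mmx] /= mx] /= mmux]] := filter_ex Uxy.
by rewrite -mmux -mx.
Qed.

Theorem corollary1p5 (G : sgraph) (d alpha beta : nat) :
  locally_finite G ->
  connected_graph G ->
  amply_regular G d alpha beta ->
  1 < beta ->
  (exists2 n, ~~ odd n & [set: G] #= `I_n) \/ infinite_set [set: G] ->
  exists M : set (set G), perfect_matching M.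
Proof.
move=> lfG connG ampG beta_gt1 sizeG.
have [F finF|m mP] := matching_compactness lfG.
  pose N (A : set G) := A `|` \bigcup_(x in A) neighbors x.
  have finN A : finite_set A -> finite_set (N A).
    by move=> finA; rewrite finite_setU; split=> //; apply: bigcup_finite.
  have [n [f [evenn f_inj Wf]]] := enum_even_superset sizeG (finN _ (finN _ finF)).
  apply: (interior_matching connG ampG beta_gt1 f_inj evenn) => x Fx.
  split=> [|y xy]; first by apply: Wf; left; left.
  have Ny : N F y by right; exists x.
  by split=> [|z yz]; apply: Wf; [left | right; exists y].
have mK x : m (m x) = x by have [] := mP x.
exists [set e | exists x, e = [set x; m x]]; split; last first.
  by move=> x; exists [set x; m x]; [exists x | left].
split=> [e [x ->]|]; first by exists x, (m x); split=> //; have [] := mP x.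
move=> _ _ [x ->] [y ->] [z [/= xz yz]].
have pairE u : u = z \/ u = m z -> [set u; m u] = [set z; m z].
  by case=> ->; rewrite ?mK //; apply: setUC.
have memE u : [set u; m u] z -> u = z \/ u = m z.
  by case=> /= ->; [left | right; rewrite mK].
by rewrite (pairE x (memE x xz)) (pairE y (memE y yz)).
Qed.
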